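(* Let $R$ be a commutative ring with $1\neq 0$ and let $Q_1,Q_2$ be uniformly primary ideals of $R$. Then: (1) $Q_1\cap Q_2$ is a uniformly 2-absorbing primary ideal of $R$ with $2\text{-}ord(Q_1\cap Q_2)\leq\max\{ord(Q_1),ord(Q_2)\}$; (2) $Q_1Q_2$ is a uniformly 2-absorbing primary ideal of $R$ with $2\text{-}ord(Q_1Q_2)\leq ord(Q_1)+ord(Q_2)$.
   Context: All rings are commutative with $1\neq 0$. A proper ideal $Q$ of $R$ is uniformly primary if there exists a positive integer $n$ such that whenever $r,s\in R$ satisfy $rs\in Q$ and $r\notin Q$, then $s^n\in Q$; $ord(Q)$ denotes the smallest such $n$. A proper ideal $Q$ of $R$ is uniformly 2-absorbing primary if there exists a positive integer $n$ such that whenever $a,b,c\in R$ satisfy $abc\in Q$, $ab\notin Q$ and $ac\notin\sqrt{Q}$, then $(bc)^n\in Q$; $2\text{-}ord(Q)$ denotes the smallest such $n$. Here $\sqrt{Q}$ is the radical of $Q$. *)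

(* Defs.v *)
From HB Require Import structures.
From mathcomp Require Import all_boot all_order all_algebra.
From mathcomp Require Import boolp classical_sets.

Set Implicit Arguments.
Unset Strict Implicit.
Unset Printing Implicit Defensive.

Import GRing.Theory.
Local Open Scope classical_set_scope.
Local Open Scope ring_scope.

(* Ideals are arbitrary, not necessarily decidable, subsets of the ring.
   The library predicate [idealr_closed] includes the condition 1 \notin Q,
   so it says precisely that Q is a proper ideal. *)
Definition is_proper_ideal (R : comNzRingType) (Q : set R) : Prop :=
  idealr_closed [in Q].

Definition radical (R : comNzRingType) (Q : set R) : set R :=
  [set x | exists2 n : nat, (0 < n)%N & Q (x ^+ n)].

Definition ideal_mul (R : comNzRingType) (I J : set R) : set R :=
  [set x | exists (k : nat) (a b : 'I_k -> R),
     [/\ forall i, I (a i), forall i, J (b i) & x = \sum_(i < k) a i * b i]].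

(* The junk value 0 is taken when P has no element. *)
Definition least_nat (P : set nat) : nat :=
  xget 0%N [set n | P n /\ forall m, P m -> (n <= m)%N].

Lemma least_natP (P : set nat) :
  (exists n, P n) -> P (least_nat P) /\ forall m, P m -> (least_nat P <= m)%N.
Proof.
move=> exP; have exb : exists n, `[< P n >] by case: exP => n Pn; exists n; apply/asboolP.
suff: [set n | P n /\ forall m, P m -> (n <= m)%N] (least_nat P) by [].
apply: (xgetPex 0%N); case: (ex_minnP exb) => n /asboolP Pn minn.
by exists n; split=> // m Pm; apply: minn; apply/asboolP.
Qed.

Definition uniformly_primary_exp (R : comNzRingType) (Q : set R) : set nat :=
  [set n | (0 < n)%N /\
    forall r s : R, Q (r * s) -> ~ Q r -> Q (s ^+ n)].

Definition uniformly_primary (R : comNzRingType) (Q : set R) : Prop :=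
  is_proper_ideal Q /\ exists n, uniformly_primary_exp Q n.

Definition ord (R : comNzRingType) (Q : set R) : nat :=
  least_nat (uniformly_primary_exp Q).

Definition uniformly_2absorbing_primary_exp
    (R : comNzRingType) (Q : set R) : set nat :=
  [set n | (0 < n)%N /\
    forall a b c : R, Q (a * b * c) -> ~ Q (a * b) -> ~ radical Q (a * c) ->
      Q ((b * c) ^+ n)].

Definition uniformly_2absorbing_primary
    (R : comNzRingType) (Q : set R) : Prop :=
  is_proper_ideal Q /\ exists n, uniformly_2absorbing_primary_exp Q n.

Definition two_ord (R : comNzRingType) (Q : set R) : nat :=
  least_nat (uniformly_2absorbing_primary_exp Q).

(* Main.v *)
Require Import Defs.
From mathcomp Require Import all_boot all_order all_algebra.
From mathcomp Require Import boolp classical_sets.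
Import GRing.Theory.

Local Open Scope classical_set_scope.

(** Both claims are instances of one statement about any subset J with
    Q1 Q2 <= J <= Q1 :&: Q2, where Q1 and Q2 are primary: such a J has radical
    P1 :&: P2, with Pi the radical of Qi, and if abc lies in J while ab is
    not in J and ac is not in the radical of J, then bc lies in P1 :&: P2.

    By symmetry assume ac is not in P1. Cancelling it from abc = b(ac) in the
    primary ideal Q1 puts b in Q1, so bc is in P1. If bc were not in P2, neither
    b nor c would be, and cancelling both from abc modulo Q2 would put a in
    Q2; then ab would be in Q1 Q2, hence in J ([mul_radical_of_notin_radical]).

    The exponents follow because in a uniformly primary ideal of order n every
    element of the radical has its n-th power in the ideal
    ([radical_expr_exp]): the power max(n1, n2) of bc lies in both ideals, and
    the power n1 + n2 is a product of an element of Q1 and one of Q2. *)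

(** * Ideals and radicals *)

Section Ideals.
Set Implicit Arguments.
Unset Strict Implicit.
Local Open Scope ring_scope.
Variable R : comNzRingType.
Implicit Types (Q I J : set R) (x y : R).

Lemma is_proper_idealP Q :
  is_proper_ideal Q <->
  [/\ Q 0, ~ Q 1 & forall a x y, Q x -> Q y -> Q (a * x + y)].
Proof.
split=> [[Q0 Q1 Qlin]|[Q0 Q1 Qlin]].
  split; first by move: Q0; rewrite inE.
    by move=> Q1'; move: Q1; rewrite mem_set.
  by move=> a x y Qx Qy; have := Qlin a x y; rewrite !inE; apply.
split; rewrite ?inE //.
  by apply/negP; rewrite inE.
by move=> a x y; rewrite !inE; apply: Qlin.
Qed.

Lemma proper_ideal_mull Q x y : is_proper_ideal Q -> Q y -> Q (x * y).
Proof.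
by move=> /is_proper_idealP[Q0 _ Qlin] Qy; rewrite -[x * y]addr0; apply: Qlin.
Qed.

Lemma proper_ideal_mulr Q x y : is_proper_ideal Q -> Q x -> Q (x * y).
Proof. by rewrite mulrC; apply: proper_ideal_mull. Qed.

Lemma proper_ideal_leq_expr Q x m n :
  is_proper_ideal Q -> (m <= n)%N -> Q (x ^+ m) -> Q (x ^+ n).
Proof. by move=> hQ /subnK <- Qx; rewrite exprD; apply: proper_ideal_mull. Qed.

Lemma sub_radical Q : Q `<=` radical Q.
Proof. by move=> x Qx; exists 1%N; rewrite ?expr1. Qed.

Lemma radical_mull Q x y : is_proper_ideal Q -> radical Q y -> radical Q (x * y).
Proof.
move=> hQ [n n_gt0 Qy]; exists n => //.
by rewrite exprMn; apply: proper_ideal_mull.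
Qed.

Lemma radical_mulr Q x y : is_proper_ideal Q -> radical Q x -> radical Q (x * y).
Proof. by rewrite mulrC; apply: radical_mull. Qed.

Lemma radical_of_mul_closed I J Q x :
  (forall u v, I u -> J v -> Q (u * v)) ->
  radical I x -> radical J x -> radical Q x.
Proof.
move=> mulQ [m m_gt0 Ix] [n n_gt0 Jx]; exists (m + n)%N.
  by rewrite addn_gt0 m_gt0.
by rewrite exprD; apply: mulQ.
Qed.

Lemma proper_idealI I J :
  is_proper_ideal I -> is_proper_ideal J -> is_proper_ideal (I `&` J).
Proof.
move=> /is_proper_idealP[I0 I1 Ilin] /is_proper_idealP[J0 _ Jlin].
apply/is_proper_idealP; split=> [//|[/I1]//|a x y [Ix Jx] [Iy Jy]].
by split; [apply: Ilin | apply: Jlin].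
Qed.

Lemma mem_ideal_mul I J x y : I x -> J y -> ideal_mul I J (x * y).
Proof.
move=> Ix Jy; exists 1%N, (fun=> x), (fun=> y).
by split=> //; rewrite big_ord1.
Qed.

Lemma ideal_mul_subI I J :
  is_proper_ideal I -> is_proper_ideal J -> ideal_mul I J `<=` I `&` J.
Proof.
move=> hI hJ _ [k [a [b [Ia Jb ->]]]].
have hIJ : is_proper_ideal (I `&` J) by apply: proper_idealI.
have /is_proper_idealP[IJ0 _ IJlin] := hIJ.
apply: (big_ind (I `&` J)) => [//|x y IJx IJy|i _].
  by rewrite -[x]mul1r; apply: IJlin.
by split; [apply: proper_ideal_mulr | apply: proper_ideal_mull].
Qed.

Lemma proper_ideal_mul I J :
  is_proper_ideal I -> is_proper_ideal J -> is_proper_ideal (ideal_mul I J).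
Proof.
move=> hI hJ; have /is_proper_idealP[_ I1 _] := hI.
apply/is_proper_idealP; split.
- by exists 0%N, (fun=> 0), (fun=> 0); split=> [[]|[]|] //; rewrite big_ord0.
- by move=> /(ideal_mul_subI hI hJ)[].
move=> c _ _ [k [a [b [Ia Jb ->]]]] [l [a' [b' [Ia' Jb' ->]]]].
exists (k + l)%N.
exists (fun i => match split i with inl j => c * a j | inr j => a' j end).
exists (fun i => match split i with inl j => b j | inr j => b' j end).
split=> [i|i|]; first by case: split => j //; apply: proper_ideal_mull.
  by case: split.
rewrite big_split_ord mulr_sumr /=; congr (_ + _); apply: eq_bigr => i _.
  by have /= -> := unsplitK (inl i : 'I_k + 'I_l); rewrite mulrA.
by have /= -> := unsplitK (inr i : 'I_k + 'I_l).
Qed.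

End Ideals.

(** * Uniformly primary ideals *)

Section Primary.
Set Implicit Arguments.
Unset Strict Implicit.
Local Open Scope ring_scope.
Variable R : comNzRingType.
Implicit Types (Q J : set R) (a b c r s x : R).

Lemma ord_exp Q : uniformly_primary Q -> uniformly_primary_exp Q (ord Q).
Proof. by case=> _ /least_natP[]. Qed.

Lemma uniformly_primary_cancel Q r s :
  uniformly_primary Q -> Q (r * s) -> ~ radical Q s -> Q r.
Proof.
move=> [_ [n [n_gt0 primQ]]] Qrs rad's; apply: contrapT => Q'r.
by apply: rad's; exists n => //; apply: primQ Q'r.
Qed.

(** The least m with x ^+ m in Q is positive since Q is proper, so
    x ^+ m = x ^+ m.-1 * x has its first factor outside Q. *)
Lemma radical_expr_exp Q n x :
  is_proper_ideal Q -> uniformly_primary_exp Q n -> radical Q x -> Q (x ^+ n).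
Proof.
move=> /is_proper_idealP[_ Q1 _] [_ primQ] [m _].
elim: m => [|m IHm]; first by rewrite expr0.
rewrite exprSr => Qxm; have [/IHm//|Q'xm] := pselect (Q (x ^+ m)).
exact: primQ Q'xm.
Qed.

Lemma radical_expr_ord Q x :
  uniformly_primary Q -> radical Q x -> Q (x ^+ ord Q).
Proof. by move=> hQ; apply: radical_expr_exp (ord_exp hQ); case: hQ. Qed.

(** Cancelling a * c modulo Q1 gives b in Q1, hence b * c in its radical. If
    b * c were outside the radical of Q2, so would b and c be, and cancelling
    both modulo Q2 would give a in Q2, the excluded configuration. *)
Lemma mul_radical_of_notin_radical Q1 Q2 a b c :
  uniformly_primary Q1 -> uniformly_primary Q2 ->
  Q1 (a * b * c) -> Q2 (a * b * c) -> ~ (Q1 b /\ Q2 a) ->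
  ~ radical Q1 (a * c) -> radical Q1 (b * c) /\ radical Q2 (b * c).
Proof.
move=> h1 h2 Q1abc Q2abc notQ12 rad'ac; have [id1 _] := h1; have [id2 _] := h2.
have Q1b : Q1 b.
  by apply: (@uniformly_primary_cancel _ b (a * c)) => //; rewrite mulrCA mulrA.
split; first exact/radical_mulr/sub_radical.
apply: contrapT => rad'bc; apply: notQ12; split=> //.
have rad'b : ~ radical Q2 b by move=> /(radical_mulr c id2).
have rad'c : ~ radical Q2 c by move=> /(radical_mull b id2).
apply: (@uniformly_primary_cancel _ a b) => //.
exact: (@uniformly_primary_cancel _ (a * b) c).
Qed.

(** An element outside the radical of J is outside that of Q1 or that of Q2, and
    the roles of Q1 and Q2 can be exchanged. Since a * b is not in J, neither
    factor can lie in Q1 with the other one in Q2. *)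
Lemma mul_radical_of_between Q1 Q2 J a b c :
  uniformly_primary Q1 -> uniformly_primary Q2 ->
  J `<=` Q1 `&` Q2 -> (forall x y, Q1 x -> Q2 y -> J (x * y)) ->
  J (a * b * c) -> ~ J (a * b) -> ~ radical J (a * c) ->
  radical Q1 (b * c) /\ radical Q2 (b * c).
Proof.
move=> h1 h2 JQ mulJ /JQ[Q1abc Q2abc] J'ab rad'ac.
have [rad1|rad'1] := pselect (radical Q1 (a * c)).
  suff [] : radical Q2 (b * c) /\ radical Q1 (b * c) by [].
  apply: (@mul_radical_of_notin_radical _ _ a) => //.
    by move=> [Q2b Q1a]; apply: J'ab; apply: mulJ.
  by move=> rad2; apply: rad'ac; apply: radical_of_mul_closed rad1 rad2.
apply: (@mul_radical_of_notin_radical _ _ a) => //.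
by move=> [Q1b Q2a]; apply: J'ab; rewrite mulrC; apply: mulJ.
Qed.

(** Common to intersections and products: only the exponent n that brings the
    common radical into J differs between the two. *)
Lemma uniformly_2absorbing_primary_of_between Q1 Q2 J n :
  uniformly_primary Q1 -> uniformly_primary Q2 -> is_proper_ideal J ->
  J `<=` Q1 `&` Q2 -> (forall x y, Q1 x -> Q2 y -> J (x * y)) -> (0 < n)%N ->
  (forall x, radical Q1 x -> radical Q2 x -> J (x ^+ n)) ->
  uniformly_2absorbing_primary J /\ (two_ord J <= n)%N.
Proof.
move=> h1 h2 idJ JQ mulJ n_gt0 expJ.
have Jn : uniformly_2absorbing_primary_exp J n.
  split=> // a b c Jabc J'ab rad'ac.
  have [] := mul_radical_of_between h1 h2 JQ mulJ Jabc J'ab rad'ac.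
  exact: expJ.
have exJ : exists n, uniformly_2absorbing_primary_exp J n by exists n.
by split=> //; have [_] := least_natP exJ; apply.
Qed.

End Primary.

(** * Intersections and products *)

Theorem theorem2p20 (R : comNzRingType) (Q1 Q2 : set R)
    (hQ1 : uniformly_primary Q1) (hQ2 : uniformly_primary Q2) :
  (uniformly_2absorbing_primary (Q1 `&` Q2) /\
   (two_ord (Q1 `&` Q2) <= maxn (ord Q1) (ord Q2))%N) /\
  (uniformly_2absorbing_primary (ideal_mul Q1 Q2) /\
   (two_ord (ideal_mul Q1 Q2) <= ord Q1 + ord Q2)%N).
Proof.
have [id1 _] := hQ1; have [id2 _] := hQ2; have [ord1_gt0 _] := ord_exp hQ1.
split; apply: (@uniformly_2absorbing_primary_of_between _ Q1 Q2) => //.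
- exact: proper_idealI.
- by move=> x y Q1x Q2y; split; [apply: proper_ideal_mulr | apply: proper_ideal_mull].
- by rewrite leq_max ord1_gt0.
- move=> x rad1 rad2; split.
    exact: proper_ideal_leq_expr id1 (leq_maxl _ _) (radical_expr_ord hQ1 rad1).
  exact: proper_ideal_leq_expr id2 (leq_maxr _ _) (radical_expr_ord hQ2 rad2).
- exact: proper_ideal_mul.
- exact: ideal_mul_subI.
- exact: mem_ideal_mul.
- by rewrite addn_gt0 ord1_gt0.
- by move=> x rad1 rad2; rewrite exprD; apply: mem_ideal_mul; apply: radical_expr_ord.
Qed.
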